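(* Let $R$ be a ring with two ideals $I$ and $J$ such that $I\neq R$, $J\neq R$ and $I\cap J=0$, and regard $R\subseteq R/I\times R/J$ as a ring extension via the canonical injective map. Then $R\subseteq R/I\times R/J$ is a $\Delta_0$-extension, and it has FIP if and only if $R/(I+J)$ has only finitely many ideals.
   Context: All rings considered are commutative and unital, and $R$ is nonzero. For a ring extension $R\subseteq S$, $[R,S]$ is the set of all $R$-subalgebras of $S$; the extension has FIP if $[R,S]$ is finite. $R\subseteq S$ is a $\Delta_0$-extension if each $R$-submodule of $S$ containing $R$ is an element of $[R,S]$ (i.e. is a subring of $S$). *)

(* Defs.v *)
From HB Require Import structures.
From mathcomp Require Import all_boot all_order all_algebra.
From mathcomp Require Import generic_quotient ring_quotient.
From mathcomp Require Import boolp classical_sets cardinality.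

Set Implicit Arguments.
Unset Strict Implicit.
Unset Printing Implicit Defensive.

Import GRing.Theory.
Local Open Scope classical_set_scope.
Local Open Scope quotient_scope.
Local Open Scope ring_scope.

(* A ring extension of R is a commutative R-algebra S whose structure map     *)
(* r |-> r%:A is injective; this map plays the role of the inclusion.         *)
Section Extensions.
Variables (R : comNzRingType) (S : comAlgType R).

Definition ring_extension := injective (in_alg S).

Definition subalgebras : set (set S) :=
  [set T : set S | subalg_closed [in T]].

Definition FIP_extension := ring_extension /\ finite_set subalgebras.

Definition Delta0_extension :=
  ring_extension /\
  (forall M : set S, submod_closed [in M] -> (forall r : R, r%:A \in M) ->
     M \in subalgebras).

End Extensions.

Arguments subalgebras {R} S.

(* Unlike idealr_closed, this allows the unit ideal and the zero ring.        *)
Definition ideals (A : comPzRingType) : set (set A) :=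
  [set K : set A | 0 \in K /\
                   forall a, {in K &, forall u v : A, a * u + v \in K}].

Arguments ideals : clear implicits.

Section QuotientAlgebra.
Variables (R : comNzRingType) (I : idealr R).
Implicit Types (a b : R) (x y : {ideal_quot I}).

Definition quot_scale a x : {ideal_quot I} := \pi_{ideal_quot I} a * x.

Fact quot_scaleA a b x : quot_scale a (quot_scale b x) = quot_scale (a * b) x.
Proof. by rewrite /quot_scale rmorphM mulrA. Qed.

Fact quot_scale1 : left_id 1 quot_scale.
Proof. by move=> x; rewrite /quot_scale rmorph1 mul1r. Qed.

Fact quot_scaleDr : right_distributive quot_scale +%R.
Proof. by move=> a x y; rewrite /quot_scale mulrDr. Qed.

Fact quot_scaleDl x : {morph quot_scale^~ x : a b / a + b}.
Proof. by move=> a b; rewrite /quot_scale rmorphD mulrDl. Qed.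

HB.instance Definition _ := GRing.Zmodule_isLmodule.Build R {ideal_quot I}
  quot_scaleA quot_scale1 quot_scaleDr quot_scaleDl.

Fact quot_scaleAl a x y : a *: (x * y) = a *: x * y.
Proof. exact: mulrA. Qed.

HB.instance Definition _ :=
  GRing.Lmodule_isLalgebra.Build R {ideal_quot I} quot_scaleAl.

Fact quot_scaleAr a x y : a *: (x * y) = x * (a *: y).
Proof. exact: mulrCA. Qed.

HB.instance Definition _ :=
  GRing.Lalgebra_isAlgebra.Build R {ideal_quot I} quot_scaleAr.

End QuotientAlgebra.

Fact in_alg_quot_pairE (R : comNzRingType) (I J : idealr R) (r : R) :
  in_alg ({ideal_quot I} * {ideal_quot J})%type r =
  (\pi_{ideal_quot I} r, \pi_{ideal_quot J} r).
Proof. by congr pair; exact: mulr1. Qed.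

(* The ring R / (I + J). It is the zero ring when I + J = R, so the ring      *)
(* instance of {ideal_quot _}, which requires a proper ideal, cannot be used. *)
Section SumQuotient.
Variables (R : comNzRingType) (I J : idealr R).

Definition in_ideal_sum (x : R) : bool :=
  `[< exists u v, [/\ u \in I, v \in J & x = u + v] >].

Fact ideal_sum_closed : zmod_closed in_ideal_sum.
Proof.
split=> [|x y /asboolP[u [v [uI vJ ->]]] /asboolP[u' [v' [uI' vJ' ->]]]].
  by apply/asboolP; exists 0, 0; rewrite !rpred0 addr0.
apply/asboolP; exists (u - u'), (v - v').
by rewrite !rpredB // opprD addrACA.
Qed.

HB.instance Definition _ :=
  GRing.isZmodClosed.Build R in_ideal_sum ideal_sum_closed.
Definition ideal_sum : zmodClosed R := GRing.ZmodClosed.clone R in_ideal_sum _.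

Fact ideal_sumMr a x : x \in ideal_sum -> a * x \in ideal_sum.
Proof.
move=> /asboolP[u [v [uI vJ ->]]]; apply/asboolP; exists (a * u), (a * v).
by rewrite !idealMr // mulrDr.
Qed.

Definition sum_quot : Type := {ideal_quot ideal_sum}.
HB.instance Definition _ := EqQuotient.on sum_quot.
HB.instance Definition _ := GRing.Zmodule.on sum_quot.

Definition sum_quot_one : sum_quot := \pi_sum_quot 1.
Definition sum_quot_mul (x y : sum_quot) : sum_quot :=
  \pi_sum_quot (repr x * repr y).

Fact sum_quot_eq (x y : R) :
  (\pi_sum_quot x == \pi_sum_quot y) = (x - y \in ideal_sum).
Proof. by rewrite (Quotient.idealrBE ideal_sum). Qed.

Fact sum_quot_pi_mul :
  {morph \pi_sum_quot : x y / x * y >-> sum_quot_mul x y}.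
Proof.
move=> x y; apply/eqP; rewrite sum_quot_eq.
set x' := repr _; set y' := repr _.
have -> : x * y - x' * y' = y * (x - x') + x' * (y - y').
  by rewrite !mulrBr [y * x]mulrC [y * x']mulrC addrA subrK.
by rewrite rpredD // ideal_sumMr // -sum_quot_eq reprK.
Qed.

Fact sum_quot_pi_add : {morph \pi_sum_quot : x y / x + y >-> x + y}.
Proof. exact: (@pi_addr _ _ _ _ _ {ideal_quot ideal_sum}). Qed.

Fact sum_quot_mulA : associative sum_quot_mul.
Proof.
move=> x y z; rewrite -[x]reprK -[y]reprK -[z]reprK.
rewrite -(sum_quot_pi_mul (repr y)) -(sum_quot_pi_mul (repr x) (repr y)).
by rewrite -!sum_quot_pi_mul mulrA.
Qed.

Fact sum_quot_mulC : commutative sum_quot_mul.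
Proof. by move=> x y; rewrite /sum_quot_mul mulrC. Qed.

Fact sum_quot_mul1 : left_id sum_quot_one sum_quot_mul.
Proof. by move=> x; rewrite -[x]reprK -sum_quot_pi_mul mul1r. Qed.

Fact sum_quot_mulDl : left_distributive sum_quot_mul +%R.
Proof.
move=> x y z; rewrite -[x]reprK -[y]reprK -[z]reprK.
by rewrite -sum_quot_pi_add -!sum_quot_pi_mul -sum_quot_pi_add mulrDl.
Qed.

HB.instance Definition _ := GRing.Zmodule_isComPzRing.Build sum_quot
  sum_quot_mulA sum_quot_mulC sum_quot_mul1 sum_quot_mulDl.

End SumQuotient.

(* Main.v *)
Require Import Defs.
From HB Require Import structures.
From mathcomp Require Import all_boot all_order all_algebra.
From mathcomp Require Import generic_quotient ring_quotient.
From mathcomp Require Import boolp classical_sets cardinality.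
Import GRing.Theory.
Local Open Scope classical_set_scope.
Local Open Scope ring_scope.

(** Write S for R/I x R/J. The difference map delta : S -> R/(I+J), sending
(a mod I, b mod J) to a - b mod I+J ([diff_modE]), is R-linear and onto, and its
kernel is the image of R: if a - b = u + v with u in I and v in J, then
r = a - u = b + v represents both coordinates. Hence

  0 -> R -> S -> R/(I+J) -> 0

is an exact sequence of R-modules ([diff_mod_eq0], [diff_mod_surj]), injectivity
on the left being the hypothesis that I and J meet in 0.

The extension is Delta_0 because products in S reduce to R-linear combinations:
for x = (a, b) and y = (c, d), the element y - d vanishes on the second
coordinate, so multiplying it by x is the same as multiplying it by a. Thus
x y = d x + a (y - d) ([pair_mulE]), and a submodule containing R, x and y
contains x y.

Consequently the subalgebras of S are exactly the R-submodules of S containing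
R, and by the exact sequence these correspond bijectively, through image and
preimage under delta, to the R-submodules of R/(I+J), which are its ideals. One
collection is therefore finite exactly when the other is. *)

(** * The exact sequence of R in R/I x R/J *)

Section QuotientPair.
Variables (R : comNzRingType) (I J : idealr R).

Local Notation S := ({ideal_quot I} * {ideal_quot J})%type.
Local Notation piI := (\pi_{ideal_quot I})%qT.
Local Notation piJ := (\pi_{ideal_quot J})%qT.
Local Notation piIJ := (\pi_(sum_quot I J))%qT.

Lemma in_alg_quot_pair_inj :
  [set` I] `&` [set` J] = [set 0] -> injective (in_alg S).
Proof.
move=> IJ0 r s; rewrite !in_alg_quot_pairE => -[/eqP rsI /eqP rsJ].
rewrite -!Quotient.idealrBE in rsI rsJ.
have : ([set` I] `&` [set` J]) (r - s) by split.
by rewrite IJ0 => /eqP; rewrite subr_eq0 => /eqP.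
Qed.

Lemma quot_pairP (x : S) : exists a b, x = (piI a, piJ b).
Proof. by case: x => x y; exists (repr x), (repr y); rewrite !reprK. Qed.

Lemma quot_pair_scale (r a b : R) :
  r *: ((piI a, piJ b) : S) = (piI (r * a), piJ (r * b)).
Proof. by rewrite !rmorphM. Qed.

(** Since y - d has second coordinate 0, multiplying it by x = (a, b) is scaling
it by a. *)
Lemma pair_mulE (a b c d : R) :
  ((piI a, piJ b) : S) * (piI c, piJ d) =
  d *: ((piI a, piJ b) : S) + a *: ((piI c, piJ d) - in_alg S d).
Proof.
rewrite in_alg_quot_pairE.
have -> : ((piI c, piJ d) : S) - (piI d, piJ d) = (piI (c - d), piJ (d - d))
  by rewrite !rmorphB.
rewrite !quot_pair_scale subrr mulr0.
have -> : ((piI (d * a), piJ (d * b)) : S) + (piI (a * (c - d)), piJ 0) =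
          (piI (d * a + a * (c - d)), piJ (d * b + 0)) by rewrite !rmorphD.
by rewrite mulrBr [d * a]mulrC [d * b]mulrC addr0 addrC subrK !rmorphM.
Qed.

(** The subtraction of representatives in R gives a well-defined map because the
class modulo I + J forgets which representatives were chosen; see [diff_modE]. *)
Definition diff_mod (x : S) : sum_quot I J := piIJ (repr x.1 - repr x.2).

Lemma diff_modE (a b : R) : diff_mod (piI a, piJ b) = piIJ (a - b).
Proof.
apply/eqP; rewrite /diff_mod sum_quot_eq /=.
apply/asboolP; exists (repr (piI a) - a), (b - repr (piJ b)); split.
- by rewrite Quotient.idealrBE reprK.
- by rewrite Quotient.idealrBE reprK.
- by rewrite opprB [b - _]addrC addrACA [- _ + _]addrC.
Qed.

(** Scalars act on the quotient by I + J through its projection, so this is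
R-linearity; the R-submodules of the quotient are then its ideals. *)
Lemma diff_mod_lin (r : R) (x y : S) :
  diff_mod (r *: x + y) = piIJ r * diff_mod x + diff_mod y.
Proof.
have [a [b ->]] := quot_pairP x; have [c [d ->]] := quot_pairP y.
rewrite quot_pair_scale.
have -> : ((piI (r * a), piJ (r * b)) : S) + (piI c, piJ d) =
          (piI (r * a + c), piJ (r * b + d)) by rewrite !rmorphD.
rewrite !diff_modE -[piIJ r * _]sum_quot_pi_mul -sum_quot_pi_add.
by rewrite mulrBr opprD addrACA.
Qed.

Lemma pi_sum_quot0 : piIJ 0 = 0.
Proof. by apply: (@addrI _ (piIJ 0)); rewrite -sum_quot_pi_add !addr0. Qed.

Lemma diff_mod_in_alg (r : R) : diff_mod (in_alg S r) = 0.
Proof. by rewrite in_alg_quot_pairE diff_modE subrr pi_sum_quot0. Qed.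

Lemma diff_mod0 : diff_mod 0 = 0.
Proof. by rewrite -(diff_mod_in_alg 0) [in_alg S 0]scale0r. Qed.

(** Exactness in the middle: a pair whose coordinates agree modulo I + J has a
common representative, obtained by moving the I-part of the discrepancy to one
side and the J-part to the other. *)
Lemma diff_mod_eq0 (x : S) : diff_mod x = 0 -> exists r, x = in_alg S r.
Proof.
have [a [b ->]] := quot_pairP x; rewrite diff_modE -pi_sum_quot0 => /eqP.
rewrite sum_quot_eq subr0 => /asboolP[u [v [uI vJ abE]]].
exists (a - u); rewrite in_alg_quot_pairE.
congr pair; apply/eqP; rewrite -Quotient.idealrBE.
  by rewrite opprB addrC subrK.
have -> : b - (a - u) = - v.
  by rewrite -[v](addKr u) -abE [- u + _]addrC !opprB addrCA.
by rewrite rpredN.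
Qed.

Lemma diff_mod_surj (z : sum_quot I J) : exists x, diff_mod x = z.
Proof.
by exists (piI (repr z), piJ 0); rewrite diff_modE subr0 reprK.
Qed.

(** * Submodules containing R *)

(** This is the Delta_0 property: [pair_mulE] turns closure under products into
closure under linear combinations of x, y and R. *)
Lemma submod_subalg (M : set S) :
  submod_closed [in M] -> (forall r : R, r%:A \in M) -> M \in subalgebras S.
Proof.
move=> [_ Mlin] RM; apply/mem_set; split => //; first by rewrite -(scale1r 1) RM.
move=> x y xM yM.
have [a [b xE]] := quot_pairP x; have [c [d yE]] := quot_pairP y.
rewrite xE yE pair_mulE -xE -yE.
have M0 : 0 \in M by rewrite -(scale0r 1) RM.
have ydM : y - in_alg S d \in M.
  by rewrite addrC -scaleN1r; apply: Mlin => //; exact: RM.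
by apply: (Mlin) => //; rewrite -[_ *: _]addr0; apply: Mlin.
Qed.

Lemma diff_mod_image_ideal (T : set S) :
  subalgebras S T -> ideals (sum_quot I J) (diff_mod @` T).
Proof.
move=> /GRing.subalg_closedZ[T0 Tlin].
split; first by apply/mem_set; exists 0; [exact: set_mem|exact: diff_mod0].
move=> z _ _ /set_mem[x xT <-] /set_mem[y yT <-]; apply/mem_set.
exists (repr z *: x + y); last by rewrite diff_mod_lin reprK.
by apply/set_mem/Tlin; apply/mem_set.
Qed.

(** The preimage of an ideal is visibly just a submodule containing R, the kernel
of the difference map; the Delta_0 property makes it a subring. *)
Lemma diff_mod_preimage_subalg (K : set (sum_quot I J)) :
  ideals (sum_quot I J) K -> subalgebras S (diff_mod @^-1` K).
Proof.
move=> [K0 Klin]; apply/set_mem; apply: submod_subalg; first split.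
- by apply/mem_set; rewrite /preimage /= diff_mod0; exact: set_mem.
- move=> r x y /set_mem xK /set_mem yK; apply/mem_set.
  rewrite /preimage /= diff_mod_lin.
  by apply/set_mem/Klin; apply/mem_set.
- move=> r; apply/mem_set.
  by rewrite /preimage /= [diff_mod _]diff_mod_in_alg; exact: set_mem.
Qed.

(** A subalgebra contains R, the kernel of the difference map, hence is saturated. *)
Lemma diff_mod_imageK (T : set S) :
  subalgebras S T -> diff_mod @^-1` (diff_mod @` T) = T.
Proof.
move=> algT; have [T1 Tlin _] := algT.
apply/seteqP; split=> [x [y yT yx]|x xT]; last by exists x.
have [T0 _] : submod_closed [in T] by exact: GRing.subalg_closedZ.
(* Elements with the same difference differ by an element of R, that is, by a
   scalar multiple of 1. *)
have [|r rE] := @diff_mod_eq0 (-1 *: y + x).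
  by rewrite diff_mod_lin -yx -diff_mod_lin scaleN1r addNr diff_mod0.
have -> : x = 1 *: y + in_alg S r.
  by rewrite -rE scale1r scaleN1r addrA subrr add0r.
apply/set_mem/Tlin; first exact/mem_set.
by rewrite -[in_alg S r]addr0; exact: Tlin.
Qed.

Lemma diff_mod_preimageK (K : set (sum_quot I J)) :
  diff_mod @` (diff_mod @^-1` K) = K.
Proof.
apply/seteqP; split=> [_ [x xK <-] //|z zK].
by have [x xz] := diff_mod_surj z; exists x; rewrite // /preimage /= xz.
Qed.

(** Image and preimage under the difference map are mutually inverse, so each
collection is contained in an image of the other. *)
Lemma finite_subalgebras_ideals :
  finite_set (subalgebras S) <-> finite_set (ideals (sum_quot I J)).
Proof.
split=> [finT|finK].
  apply: sub_finite_set (finite_image (fun T => diff_mod @` T) finT) => K idK.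
  exists (diff_mod @^-1` K); first exact: diff_mod_preimage_subalg.
  exact: diff_mod_preimageK.
apply: sub_finite_set (finite_image (fun K => diff_mod @^-1` K) finK) => T algT.
exists (diff_mod @` T); first exact: diff_mod_image_ideal.
exact: diff_mod_imageK.
Qed.

End QuotientPair.

Theorem proposition3p2 (R : comNzRingType) (I J : idealr R)
    (IJ0 : [set` I] `&` [set` J] = [set 0]) :
  Delta0_extension ({ideal_quot I} * {ideal_quot J})%type /\
  (FIP_extension ({ideal_quot I} * {ideal_quot J})%type <->
   finite_set (ideals (sum_quot I J))).
Proof.
have inj := @in_alg_quot_pair_inj R I J IJ0.
split; first by split=> //; exact: submod_subalg.
have [finTK finKT] := finite_subalgebras_ideals R I J.
by split=> [[_ /finTK]|/finKT].
Qed.
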